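(* Let $d\in\mathbb{N}$, $0<p,q\le\infty$, $0<r<\infty$ and $-\infty<s<\infty$. Then, for every $f\in\mathcal S(\mathbb{R}^d)$, $$\lim_{b\to0-}(1-2^{br})^{1/r}\,\|f\|^*_{T^b_rB^s_{p,q}(\mathbb{R}^d)}=\|f\|_{B^s_{p,q}(\mathbb{R}^d)}$$ and if, additionally, $p<\infty$, then $$\lim_{b\to0-}(1-2^{br})^{1/r}\,\|f\|^*_{T^b_rF^s_{p,q}(\mathbb{R}^d)}=\|f\|_{F^s_{p,q}(\mathbb{R}^d)}.$$
   Context: $\widehat{f}$, $f^\vee$ denote the Fourier transform and its inverse on $\mathcal{S}'(\mathbb{R}^d)$. $(\varphi_j)_{j\ge 0}$ is a fixed usual smooth dyadic resolution of unity: $\varphi_0\in C_c^\infty(\mathbb{R}^d)$, $\varphi_0=1$ for $|\xi|\le 1$, $\operatorname{supp}\varphi_0\subset\{|\xi|\le 2\}$, $\varphi_j(\xi)=\varphi_0(2^{-j}\xi)-\varphi_0(2^{-j+1}\xi)$ for $j\ge1$; the same $(\varphi_j)$ is used in all quasi-norms below (usual modifications if $q=\infty$): $$\|f\|_{B^{s}_{p,q}}=\Big(\sum_{j\ge0}2^{jsq}\|(\varphi_j\widehat f)^\vee\|_{L_p}^q\Big)^{1/q},\qquad \|f\|_{F^{s}_{p,q}}=\Big\|\Big(\sum_{j\ge0}2^{jsq}|(\varphi_j\widehat f)^\vee|^q\Big)^{1/q}\Big\|_{L_p},$$ and, for $b<0$, $$\|f\|^*_{T^b_rB^s_{p,q}}=\Big(\sum_{j=0}^\infty2^{jbr}\Big(\sum_{\nu=0}^{2^j}2^{\nu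 sq}\|(\varphi_\nu\widehat f)^\vee\|_{L_p}^q\Big)^{r/q}\Big)^{1/r},$$ $$\|f\|^*_{T^b_rF^s_{p,q}}=\Big(\sum_{j=0}^\infty2^{jbr}\Big\|\Big(\sum_{\nu=0}^{2^j}2^{\nu sq}|(\varphi_\nu\widehat f)^\vee|^q\Big)^{1/q}\Big\|_{L_p}^r\Big)^{1/r}.$$ *)

(* Defs.v *)
From HB Require Import structures.
From mathcomp Require Import all_boot all_order all_algebra.
From mathcomp Require Import complex.
From mathcomp Require Import all_classical all_reals all_analysis.

Set Implicit Arguments.
Unset Strict Implicit.
Unset Printing Implicit Defensive.

Import Order.TTheory GRing.Theory Num.Theory.
Import numFieldNormedType.Exports.

Local Open Scope classical_set_scope.
Local Open Scope ring_scope.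
Local Open Scope complex_scope.

Local Notation Re := complex.Re.
Local Notation Im := complex.Im.
Local Notation normc := ComplexField.Normc.normc.

(* 'rV[R]_n carries the sigma-algebra generated by the coordinates, which is
   the Borel one. *)
Definition measure_rV_display : measure_display -> measure_display.
Proof. exact. Qed.

Section measurable_rV.
Context {R : realType}.
Variable n : nat.

Let coors : 'I_n -> 'rV[R]_n -> R := fun i x => x ord0 i.

Let rV_set0 : g_sigma_preimage coors set0.
Proof. exact: sigma_algebra0. Qed.

Let rV_setC A : g_sigma_preimage coors A -> g_sigma_preimage coors (~` A).
Proof. exact: sigma_algebraC. Qed.

Let rV_bigcup (F : _^nat) : (forall i, g_sigma_preimage coors (F i)) ->
  g_sigma_preimage coors (\bigcup_i (F i)).
Proof. exact: sigma_algebra_bigcup. Qed.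

HB.instance Definition _ :=
  @isMeasurable.Build (measure_rV_display default_measure_display)
    'rV[R]_n (g_sigma_preimage coors) rV_set0 rV_setC rV_bigcup.

End measurable_rV.

Section measurable_rV_lemmas.
Context {R : realType}.

Lemma measurable_coord n (i : 'I_n) :
  measurable_fun [set: 'rV[R]_n] (fun x : 'rV[R]_n => x ord0 i).
Proof.
move=> _ Y mY; rewrite setTI; apply: sub_sigma_algebra => /=.
rewrite -bigcup_seq/=; exists i => /=; first by rewrite mem_index_enum.
by exists Y => //; rewrite setTI.
Qed.

Lemma measurable_fun_rVP d (T : measurableType d) n (f : T -> 'rV[R]_n) :
  (forall i, measurable_fun [set: T] (fun x => f x ord0 i)) ->
  measurable_fun [set: T] f.
Proof.
move=> mf _ A mA; rewrite setTI.
suff : g_sigma_preimage (fun i (x : 'rV[R]_n) => x ord0 i) `<=`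
    [set B | measurable (f @^-1` B)] by move/(_ _ mA).
apply: smallest_sub.
  split => [|B mB|F mF].
  - by rewrite /= preimage_set0.
  - by rewrite /= setTD preimage_setC; exact: measurableC.
  - by rewrite /= preimage_bigcup; apply: bigcup_measurable => k _; exact: mF.
move=> B; rewrite -bigcup_seq/= => -[i _ [C mC <-]] /=.
by rewrite setTI -comp_preimage -[X in measurable X]setTI; exact: mf.
Qed.

Definition rV_cons n (x : measurableTypeR R * 'rV[R]_n) : 'rV[R]_n.+1 :=
  row_mx (x.1)%:M x.2 : 'rV[R]_(1 + n).

Definition rV_uncons n (x : 'rV[R]_n.+1) : measurableTypeR R * 'rV[R]_n :=
  (x ord0 ord0, \row_i x ord0 (lift ord0 i)).

Lemma rV_cons0 n (x : measurableTypeR R * 'rV[R]_n) : rV_cons x ord0 ord0 = x.1.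
Proof.
have -> : @ord0 n = lshift n (@ord0 0) by exact/val_inj.
by rewrite [LHS]row_mxEl mxE eqxx.
Qed.

Lemma rV_consS n (x : measurableTypeR R * 'rV[R]_n) i :
  rV_cons x ord0 (lift ord0 i) = x.2 ord0 i.
Proof.
have -> : lift ord0 i = rshift 1 i by exact/val_inj.
by rewrite [LHS]row_mxEr.
Qed.

Lemma rV_consK n : cancel (@rV_cons n) (@rV_uncons n).
Proof.
move=> [x y]; rewrite /rV_uncons rV_cons0; congr pair.
by apply/rowP => i; rewrite mxE rV_consS.
Qed.

Lemma measurable_rV_cons n : measurable_fun setT (@rV_cons n).
Proof.
apply: measurable_fun_rVP => i; case: (unliftP ord0 i) => [j|] ->.
  under eq_fun do rewrite rV_consS.
  exact: (measurableT_comp (measurable_coord j) measurable_snd).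
by under eq_fun do rewrite rV_cons0; exact: measurable_fst.
Qed.

Lemma measurable_rV_uncons n : measurable_fun setT (@rV_uncons n).
Proof.
apply: measurable_fun_pair; first exact: measurable_coord.
apply: measurable_fun_rVP => i.
by under eq_fun do rewrite mxE; exact: measurable_coord.
Qed.

End measurable_rV_lemmas.

Section lebesgue_rV.
Context {R : realType}.

Section step.
Variables (n : nat) (m : {sigma_finite_measure set 'rV[R]_n -> \bar R}).

Let mu : {measure set (measurableTypeR R * 'rV[R]_n) -> \bar R} :=
  [the {measure set _ -> \bar R} of (lebesgue_measure \x m)%E].

Definition lebesgue_rVS : set 'rV[R]_n.+1 -> \bar R :=
  pushforward mu (@rV_cons R n).

HB.instance Definition _ := Measure.copy lebesgue_rVS
  (measure_function_pushforward__canonical__measure_function_Measure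
    mu (@measurable_rV_cons R n)).

Let lebesgue_rVS_sigma_finite : sigma_finite setT lebesgue_rVS.
Proof.
have /sigma_finiteP[F [FT ndF Ffin]] := sigma_finiteT (@lebesgue_measure R).
have /sigma_finiteP[G [GT ndG Gfin]] := sigma_finiteT m.
exists (fun k => @rV_uncons R n @^-1` (F k `*` G k)).
  apply/seteqP; split => // x _.
  have [i _ Fi] : (\bigcup_i F i) (x ord0 ord0) by rewrite -FT.
  have [j _ Gj] : (\bigcup_j G j) (rV_uncons x).2 by rewrite -GT.
  exists (maxn i j) => //; split => /=.
    by move: Fi; exact/subsetPset/ndF/leq_maxl.
  by move: Gj; exact/subsetPset/ndG/leq_maxr.
move=> k; have [mF Foo] := Ffin k; have [mG Goo] := Gfin k; split.
  rewrite -[X in measurable X]setTI; apply: measurable_rV_uncons => //.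
  exact: measurableX.
rewrite /lebesgue_rVS /pushforward/= -comp_preimage.
rewrite (_ : _ \o _ = id) ?preimage_id.
  by rewrite product_measure1E// lte_mul_pinfty// ge0_fin_numE.
by apply/funext => x /=; rewrite rV_consK.
Qed.

HB.instance Definition _ :=
  Measure_isSigmaFinite.Build _ _ _ lebesgue_rVS lebesgue_rVS_sigma_finite.

End step.

Fixpoint lebesgue_rV n : {sigma_finite_measure set 'rV[R]_n -> \bar R} :=
  if n is m.+1 return {sigma_finite_measure set 'rV[R]_n -> \bar R}
  then lebesgue_rVS (lebesgue_rV m) else \d_(0 : 'rV[R]_0).

Lemma lebesgue_rV_box n (A : 'I_n -> set R) : (forall i, measurable (A i)) ->
  lebesgue_rV n [set x | forall i, A i (x ord0 i)] =
  (\prod_(i < n) lebesgue_measure (A i))%E.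
Proof.
elim: n A => [|n ih] A mA.
  by rewrite big_ord0 /= diracE mem_set// => -[].
pose B := [set y : 'rV[R]_n | forall i, A (lift ord0 i) (y ord0 i)].
have mB : measurable B.
  rewrite (_ : B = \bigcap_(i in setT)
      ((fun x : 'rV[R]_n => x ord0 i) @^-1` A (lift ord0 i))); last first.
    by apply/seteqP; split => x /= h; [move=> i _; exact: h|move=> i; exact: h].
  apply: fin_bigcap_measurable => // i _.
  by rewrite -[X in measurable X]setTI; exact: measurable_coord.
rewrite big_ord_recl -ih//.
rewrite -[RHS](product_measure1E lebesgue_measure (lebesgue_rV n) _ mB)//; last first.
  exact: mA.
rewrite /= /lebesgue_rVS /pushforward/=.
congr (product_measure1 _ _ _); apply/seteqP; split => -[x y] /=.
  move=> h; split; first by have := h ord0; rewrite rV_cons0.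
  by move=> i; have := h (lift ord0 i); rewrite rV_consS.
move=> [Ax Ay] i; case: (unliftP ord0 i) => [j|] ->.
  by rewrite rV_consS; exact: Ay.
by rewrite rV_cons0.
Qed.

End lebesgue_rV.

Section schwartz_space.
Context {R : realType} {d : nat}.
Implicit Types (g : 'rV[R]_d -> R) (f : 'rV[R]_d -> R[i]).

(* The norm of 'rV[R]_d in the library is the maximum norm. *)
Definition enorm (x : 'rV[R]_d) : R := Num.sqrt (\sum_i x ord0 i ^+ 2).

Definition dotp (x y : 'rV[R]_d) : R := \sum_i x ord0 i * y ord0 i.

Definition pderiv g (i : 'I_d) : 'rV[R]_d -> R :=
  fun x => 'D_(delta_mx ord0 i) g x.

Definition pderivs (l : seq 'I_d) g : 'rV[R]_d -> R := foldl pderiv g l.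

(* A list l stands for the iterated partial derivative taken in the directions
   listed; lists cover all multi-indices. *)
Definition smooth g := forall l : seq 'I_d, continuous (pderivs l g) /\
  forall i x, derivable (pderivs l g) x (delta_mx ord0 i).

(* Derivatives and integrals of complex-valued functions are taken
   componentwise: the library has no normed R-module structure on R[i]. *)
Definition csmooth f := smooth (fun x => Re (f x)) /\ smooth (fun x => Im (f x)).

Definition cpderivs (l : seq 'I_d) f : 'rV[R]_d -> R[i] :=
  fun x => pderivs l (fun y => Re (f y)) x +i* pderivs l (fun y => Im (f y)) x.

Definition schwartz f := csmooth f /\
  forall (a : 'I_d -> nat) (l : seq 'I_d), exists M : R, forall x : 'rV[R]_d,
    normc ((\prod_i x ord0 i ^+ a i)%:C * cpderivs l f x) <= M.

Definition supp f : set 'rV[R]_d := closure [set x | f x != 0].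

Definition cintegral f : R[i] :=
  (\int[lebesgue_rV d]_x Re (f x)) +i* (\int[lebesgue_rV d]_x Im (f x)).

Definition expi (t : R) : R[i] := cos t +i* sin t.

(* Classical integrals: below the transforms are only applied to Schwartz
   functions, where they agree with those on tempered distributions. *)
Definition fourier f : 'rV[R]_d -> R[i] := fun xi =>
  ((2 * pi) `^ (- (d%:R / 2)))%:C *
    cintegral (fun x => expi (- dotp x xi) * f x).

Definition inv_fourier f : 'rV[R]_d -> R[i] := fun x =>
  ((2 * pi) `^ (- (d%:R / 2)))%:C *
    cintegral (fun xi => expi (dotp x xi) * f xi).

Definition dyadic_generator (phi0 : 'rV[R]_d -> R[i]) := [/\
  csmooth phi0, compact (supp phi0),
  forall xi, enorm xi <= 1 -> phi0 xi = 1 &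
  supp phi0 `<=` [set xi | enorm xi <= 2]].

Definition dyadic (phi0 : 'rV[R]_d -> R[i]) (j : nat) : 'rV[R]_d -> R[i] :=
  fun xi => if j is k.+1
    then phi0 ((2 ^- k.+1) *: xi) - phi0 ((2 ^- k) *: xi) else phi0 xi.

Definition dyadic_block phi0 (j : nat) f : 'rV[R]_d -> R[i] :=
  inv_fourier (fun xi => dyadic phi0 j xi * fourier f xi).

End schwartz_space.

Section spaces.
Context {R : realType} {d : nat}.
Variable phi0 : 'rV[R]_d -> R[i].
Implicit Types (p q : \bar R) (f : 'rV[R]_d -> R[i]).
Local Open Scope ereal_scope.

(* The l_q quasi-norm over the indices in P; q is meant to be positive. *)
Definition ell_norm q (P : pred nat) (a : nat -> \bar R) : \bar R :=
  if q is q'%:E then (\sum_(0 <= j <oo | P j) a j `^ q') `^ q'^-1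
  else ereal_sup [set a j | j in [set j | P j]].

(* BnormP and FnormP restrict the dyadic blocks to the indices in P, so that the
   full and the truncated quasi-norms are instances of them. The weight is
   moved inside the q-th power, 2^(j s q) x^q = (2^(j s) x)^q, which also gives
   the usual reading for q = +oo. *)
Definition BnormP p q (s : R) (P : pred nat) f : \bar R :=
  ell_norm q P (fun j => (2 `^ (j%:R * s))%:E *
    'N[lebesgue_rV d]_p[(fun x => (normc (dyadic_block phi0 j f x))%:E)]).

Definition FnormP p q (s : R) (P : pred nat) f : \bar R :=
  'N[lebesgue_rV d]_p[(fun x => ell_norm q P (fun j =>
    (2 `^ (j%:R * s))%:E * (normc (dyadic_block phi0 j f x))%:E))].

Definition Bnorm p q s f := BnormP p q s xpredT f.

Definition Fnorm p q s f := FnormP p q s xpredT f.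

Definition TBnorm (b r : R) p q s f : \bar R :=
  (\sum_(0 <= j <oo) (2 `^ (j%:R * b * r))%:E *
    BnormP p q s (fun nu => nu <= 2 ^ j)%N f `^ r) `^ r^-1.

Definition TFnorm (b r : R) p q s f : \bar R :=
  (\sum_(0 <= j <oo) (2 `^ (j%:R * b * r))%:E *
    FnormP p q s (fun nu => nu <= 2 ^ j)%N f `^ r) `^ r^-1.

End spaces.

(* Main.v *)
Require Import Defs.
From mathcomp Require Import all_boot all_order all_algebra.
From mathcomp Require Import complex.
From mathcomp Require Import all_classical all_reals all_analysis.
From mathcomp Require Import measurable_realfun.

(** Put x = 2^(b r), which increases to 1 as b increases to 0, and let A_j be
    the quasi-norm of f in which only the dyadic blocks of index at most 2^j
    are kept. The r-th power of the left-hand side is the Abel mean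
    (1 - x) \sum_j x^j A_j^r, a weighted mean whose weights drift to infinity
    as x tends to 1, and A_j increases to the full quasi-norm. So the theorem
    is the statement that Abel means of a nondecreasing sequence converge to
    its supremum, finite or not.

    For the supremum L of A, the mean is at most L^r because its weights add
    up to 1, and at least x^N A_N^r for every N, because the weights of the indices
    from N on add up to x^N. After extraction of the r-th root the lower bound
    reads 2^(N b) A_N, which tends to A_N as b tends to 0: this is
    [abel_mean_cvg].

    That the truncated quasi-norms have the full one as supremum is, for the
    B-scale, the same statement about the l_q quasi-norm of a nonnegative
    sequence ([ell_norm_sup_trunc]). For the F-scale this holds pointwise in
    x, and monotone convergence passes to the L_p quasi-norm
    ([Lnorm_ereal_sup]). Monotone convergence needs the blocks to be
    measurable functions of x: continuous functions on R^d are measurable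
    for the sigma-algebra generated by the coordinates, and the Fourier
    integrals inherit measurability from their integrands by the measurable
    part of Tonelli's theorem ([cmeasurable_dyadic_block]). *)

Import Order.TTheory GRing.Theory Num.Theory.
Import numFieldNormedType.Exports.

Local Open Scope classical_set_scope.
Local Open Scope ring_scope.

Local Notation Re := complex.Re.
Local Notation Im := complex.Im.
Local Notation normc := ComplexField.Normc.normc.

(** * Powers of nonnegative extended reals *)

Section ereal_power.
Context {R : realType}.
Implicit Types (x y : \bar R) (r : R).
Local Open Scope ereal_scope.

Lemma ge0_le_poweR r x y : (0 <= r)%R -> 0 <= x -> x <= y ->
  x `^ r <= y `^ r.
Proof.
move=> r0 x0 xy; apply: gt0_ler_poweR => //.
  by rewrite in_itv/= x0 leey.
by rewrite in_itv/= (le_trans x0 xy) leey.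
Qed.

Lemma poweRK r x : r != 0%R -> 0 <= x -> (x `^ r) `^ r^-1 = x.
Proof. by move=> r0 x0; rewrite -poweRrM divff// poweRe1. Qed.

Lemma poweRVK r x : r != 0%R -> 0 <= x -> (x `^ r^-1) `^ r = x.
Proof. by move=> r0 x0; rewrite -poweRrM mulVf// poweRe1. Qed.

(** One inequality is monotonicity of the r-th power, the other that of the
    r-th root; this treats finite and infinite suprema alike. *)
Lemma ereal_sup_poweR r (u : nat -> \bar R) : (0 < r)%R ->
  (forall n, 0 <= u n) ->
  ereal_sup (range (fun n => u n `^ r)) = ereal_sup (range u) `^ r.
Proof.
move=> r0 u0; have rn0 : r != 0%R by rewrite gt_eqF.
have u_le n : u n <= ereal_sup (range u) by apply: ereal_sup_ubound; exists n.
have ur_le n : u n `^ r <= ereal_sup (range (fun n => u n `^ r)).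
  by apply: ereal_sup_ubound; exists n.
apply/eqP; rewrite eq_le; apply/andP; split.
  by apply: ge_ereal_sup => _ [n _ <-]; apply: ge0_le_poweR => //; exact: ltW.
have s0 : 0 <= ereal_sup (range (fun n => u n `^ r)).
  exact: le_trans (poweR_ge0 _ _) (ur_le 0%N).
rewrite -[leRHS](@poweRVK r)//; apply: ge0_le_poweR; first exact: ltW.
  exact: le_trans (u0 0%N) (u_le 0%N).
apply: ge_ereal_sup => _ [n _ <-]; rewrite -(@poweRK r (u n))//.
by apply: ge0_le_poweR; rewrite ?invr_ge0 ?poweR_ge0// ltW.
Qed.

End ereal_power.

(** * Abel means of a nondecreasing sequence *)

Section abel.
Context {R : realType}.
Local Open Scope ereal_scope.

(** Convergence to the supremum of the values from one-sided lower bounds; it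
    covers the finite and the infinite limit at once. *)
Lemma cvge_below (T : Type) (F : set_system T) {FF : Filter F}
    (g : T -> \bar R) (L : \bar R) : L != -oo ->
  (\forall t \near F, g t <= L) ->
  (forall c : R, c%:E < L -> \forall t \near F, c%:E <= g t) ->
  g t @[t --> F] --> L.
Proof.
case: L => [l| |//] _ gL Lg; last first.
  by apply/cvgeyPge => c; apply: Lg; rewrite ltry.
have gfin : \forall t \near F, g t \is a fin_num.
  have := Lg (l - 1)%R; rewrite lte_fin gtrBl ltr01 => /(_ isT) gl.
  near=> t; rewrite fin_real//; apply/andP; split.
    by apply: (@lt_le_trans _ _ (l - 1)%:E); [rewrite ltNyr|near: t].
  by apply: (@le_lt_trans _ _ l%:E); [near: t|rewrite ltry].
apply/fine_cvgP; split => //; apply/cvgrPdist_le => e e0.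
have := Lg (l - e)%R; rewrite lte_fin gtrBl e0 => /(_ isT) gl.
near=> t; have tfin : g t \is a fin_num by near: t.
rewrite ger0_norm ?subr_ge0.
  by rewrite lerBlDr -lerBlDl -lee_fin fineK//; near: t.
by rewrite -lee_fin fineK//; near: t.
Unshelve. all: by end_near. Qed.

Lemma geometric_eseries (x c : R) N : (0 <= x < 1)%R -> (0 <= c)%R ->
  \sum_(N <= j <oo) (x ^+ j)%:E * c%:E = (c * x ^+ N / (1 - x))%:E.
Proof.
move=> /andP[x0 x1] c0.
transitivity (\sum_(0 <= j <oo) (c * x ^+ N * x ^+ j)%:E).
  rewrite -[N in LHS]add0n -nneseries_addn; last first.
    by move=> i; rewrite -EFinM lee_fin mulr_ge0// exprn_ge0.
  by apply: eq_eseriesr => i _; rewrite -EFinM exprD mulrC mulrAC mulrA.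
apply/cvg_lim => //; rewrite [X in X @ _](_ : _ =
    EFin \o series (geometric (c * x ^+ N) x))%R; last first.
  by apply/funext => n /=; rewrite sumEFin.
apply: cvg_EFin; first by exact: nearW.
by apply: cvg_geometric_series; rewrite ger0_norm.
Qed.

(** The mean lies between 2^(N b) A_N, for any N, and the supremum. The lower
    bound is used with a real number a < A_N in place of A_N, which may be
    infinite. *)
Lemma abel_mean_cvg (A : nat -> \bar R) (r : R) : (0 < r)%R ->
  (forall n, 0 <= A n) -> nondecreasing_seq A ->
  ((1 - 2 `^ (b * r)) `^ r^-1)%:E *
    (\sum_(0 <= j <oo) (2 `^ (j%:R * b * r))%:E * A j `^ r) `^ r^-1
    @[b --> (0 : R)^'-] --> ereal_sup (range A).
Proof.
move=> r0 A0 ndA; have rn0 : r != 0%R by rewrite gt_eqF.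
set L := ereal_sup _.
have AL n : A n <= L by apply: ereal_sup_ubound; exists n.
have L0 : 0 <= L by exact: le_trans (A0 0%N) (AL 0%N).
have powE (b : R) j : (2 `^ (j%:R * b * r) = (2 `^ (b * r)) ^+ j)%R.
  by rewrite -powR_mulrn ?powR_ge0// -powRrM [in RHS]mulrC mulrA.
have x01 (b : R) : (b < 0)%R -> (0 <= 2 `^ (b * r) < 1)%R.
  move=> b0; rewrite powR_ge0/= /powR gt_eqF// expR_lt1.
  by rewrite pmulr_llt0 ?ln_gt0 ?ltr1n// pmulr_llt0.
have term0 (b : R) j : 0 <= (2 `^ (j%:R * b * r))%:E * A j `^ r.
  by rewrite mule_ge0 ?poweR_ge0// lee_fin powR_ge0.
(* Abel mean of a sequence that vanishes before N and is c from N on *)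
have meanE (b c : R) N : (b < 0)%R -> (0 <= c)%R ->
    ((1 - 2 `^ (b * r)) `^ r^-1)%:E *
      (\sum_(N <= j <oo) (2 `^ (j%:R * b * r))%:E * c%:E `^ r) `^ r^-1
    = (2 `^ (N%:R * b) * c)%:E.
  move=> b0 c0; under eq_eseriesr do rewrite powE poweR_EFin.
  have /andP[x0 x1] := x01 _ b0.
  rewrite geometric_eseries ?powR_ge0 ?x0//.
  rewrite poweR_EFin -EFinM -powRM ?subr_ge0 ?(ltW x1)//; last first.
    by rewrite divr_ge0 ?mulr_ge0 ?powR_ge0 ?exprn_ge0// subr_ge0 ltW.
  rewrite mulrC divfK ?subr_eq0 ?gt_eqF// -powE powRrM -powRM ?powR_ge0//.
  by rewrite -powRrM divff// powRr1 ?mulr_ge0 ?powR_ge0// mulrC.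
apply: cvge_below; first by rewrite gt_eqF// (lt_le_trans _ L0).
  near=> b; have b0 : (b < 0)%R by near: b; exact: nbhs_left_lt.
  move: L0 AL; case: L => [l| |//] L0 AL; last by rewrite leey.
  rewrite [leRHS](_ : _ = (2 `^ (0%:R * b) * l)%:E); last first.
    by rewrite mul0r powRr0 mul1r.
  rewrite -meanE//; apply: lee_pmul => //; rewrite ?poweR_ge0//.
    by rewrite lee_fin powR_ge0.
  apply: ge0_le_poweR; rewrite ?invr_ge0 ?(ltW r0)//.
    exact: nneseries_ge0.
  apply: lee_nneseries => // j _; apply: lee_pmul; rewrite ?poweR_ge0//.
  by apply: ge0_le_poweR => //; exact: ltW.
move=> c cL; have [c0|c0] := ltP c 0%R.
  apply: nearW => b; rewrite (@le_trans _ _ 0)//; first by rewrite lee_fin ltW.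
  by rewrite mule_ge0 ?poweR_ge0// lee_fin powR_ge0.
have [a [ca aL]] : exists a : R, (c < a)%R /\ a%:E < L.
  move: cL; case: L {AL} L0 => [l _| _ _ |//]; last first.
    by exists (c + 1)%R; rewrite ltrDl ltr01 ltry.
  rewrite lte_fin => cl; exists ((c + l) / 2)%R.
  by rewrite lte_fin !midf_lt.
have a0 : (0 <= a)%R by rewrite (le_trans c0)// ltW.
have [_ [N _ <-] aN] := ereal_sup_gt aL.
have : (2 `^ (N%:R * b) * a @[b --> (0:R)^'-] --> a)%R.
  apply: cvg_at_left_filter; rewrite -[X in _ --> X]mul1r.
  apply: cvgM; last exact: cvg_cst.
  rewrite /powR gt_eqF// [X in _ --> X](_ : _ = expR (N%:R * 0 * ln 2)).
    apply: continuous_cvg; first exact: continuous_expR.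
    by do 2?[apply: cvgM]; [exact: cvg_cst|exact: cvg_id|exact: cvg_cst].
  by rewrite mulr0 mul0r expR0.
move=> /(cvgr_gt a)/(_ _ ca) ltc.
near=> b; have b0 : (b < 0)%R by near: b; exact: nbhs_left_lt.
apply: (@le_trans _ _ (2 `^ (N%:R * b) * a)%:E).
  by rewrite lee_fin ltW//; near: b.
rewrite -meanE//; apply: lee_pmul => //; rewrite ?poweR_ge0//.
  by rewrite lee_fin powR_ge0.
apply: ge0_le_poweR; rewrite ?invr_ge0 ?(ltW r0)//.
  by apply: nneseries_ge0 => j _ _; rewrite mule_ge0 ?poweR_ge0// lee_fin powR_ge0.
rewrite [leRHS](nneseries_split 0 N)// add0n.
rewrite -[leLHS]add0e leeD ?sume_ge0//.
rewrite [leLHS]eseries_cond [leRHS]eseries_cond.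
apply: lee_nneseries => [j _ _|j /andP[_ Nj]].
  by rewrite mule_ge0 ?poweR_ge0// lee_fin powR_ge0.
apply: lee_pmul; rewrite ?poweR_ge0//.
apply: ge0_le_poweR; [exact: ltW|by []|].
by rewrite (le_trans (ltW aN))// ndA.
Unshelve. all: by end_near. Qed.

End abel.

(** * Truncated l_q quasi-norms *)

Section ell.
Context {R : realType}.
Implicit Types (q : \bar R) (P Q : pred nat) (a : nat -> \bar R).
Local Open Scope ereal_scope.

Lemma le_ell_norm q P Q a : 0 < q -> (forall j, 0 <= a j) ->
  (forall j, P j -> Q j) -> ell_norm q P a <= ell_norm q Q a.
Proof.
move=> q0 a0 PQ; case: q q0 => [q| |//]; rewrite ?lte_fin => q0 /=.
  apply: ge0_le_poweR; rewrite ?invr_ge0 ?(ltW q0)//.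
    by apply: nneseries_ge0 => j _ _; exact: poweR_ge0.
  by apply: subset_lee_nneseries => // j _; exact: poweR_ge0.
by apply: ereal_sup_le => _ [j Pj <-]; exists j => //=; exact: PQ.
Qed.

(** The index 0 in P matters for q infinite, where an empty supremum is
    negative. *)
Lemma ell_norm_ge0 q P a : P 0%N -> (forall j, 0 <= a j) -> 0 <= ell_norm q P a.
Proof.
move=> P0 a0; case: q => [q| |] /=; first exact: poweR_ge0.
  by apply: le_trans (a0 0%N) _; apply: ereal_sup_ubound; exists 0%N.
by apply: le_trans (a0 0%N) _; apply: ereal_sup_ubound; exists 0%N.
Qed.

(** For finite q the first m terms of the series all survive the truncation
    at 2^m because m < 2^m. *)
Lemma ell_norm_sup_trunc q a : 0 < q -> (forall j, 0 <= a j) ->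
  ell_norm q xpredT a =
  ereal_sup (range (fun n => ell_norm q (fun nu => nu <= 2 ^ n)%N a)).
Proof.
move=> q0 a0; apply/eqP; rewrite eq_le; apply/andP; split; last first.
  by apply: ge_ereal_sup => _ [n _ <-]; exact: le_ell_norm.
case: q q0 => [q| |//]; rewrite ?lte_fin => q0 /=; last first.
  apply: ge_ereal_sup => _ [j _ <-].
  apply: le_ereal_sup_tmp; exists (ell_norm +oo (fun nu => nu <= 2 ^ j)%N a).
    by exists j.
  by apply: ereal_sup_ubound; exists j => //=; exact/ltnW/ltn_expl.
have aq0 j : 0 <= a j `^ q by exact: poweR_ge0.
rewrite ereal_sup_poweR ?invr_gt0//; last first.
  by move=> n; exact: nneseries_ge0.
apply: ge0_le_poweR; first by rewrite invr_ge0 ltW.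
  exact: nneseries_ge0.
apply: lime_le; first exact: is_cvg_nneseries.
apply: nearW => m.
apply: (@le_trans _ _ (\sum_(0 <= j <oo | (j <= 2 ^ m)%N) a j `^ q)); last first.
  by apply: ereal_sup_ubound; exists m.
rewrite big_nat_cond (eq_bigl (fun j => (0 <= j < m) && (j <= 2 ^ m))%N);
  rewrite -?big_nat_cond.
  exact: nneseries_lim_ge.
move=> j; have [jm|] := ltnP j m; rewrite ?andbF // leq0n /=.
by apply/esym/ltnW/(ltn_trans jm)/ltn_expl.
Qed.

End ell.

(** * Monotone convergence for L_p quasi-norms *)

Section Lnorm.
Context d (T : measurableType d) (R : realType).
Variable mu : {measure set T -> \bar R}.
Local Open Scope ereal_scope.

Lemma le_Lnorm (p : R) (g h : T -> \bar R) : (0 < p)%R ->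
  measurable_fun setT g -> measurable_fun setT h ->
  (forall x, 0 <= g x) -> (forall x, g x <= h x) ->
  Lnorm mu p%:E g <= Lnorm mu p%:E h.
Proof.
move=> p0 mg mh g0 gh; rewrite unlock; apply: ge0_le_poweR.
- by rewrite invr_ge0 ltW.
- by apply: integral_ge0 => x _; exact: poweR_ge0.
- have h0 x : 0 <= h x by exact: le_trans (g0 x) (gh x).
  apply: ge0_le_integral => // [x _|||x _].
  + exact: poweR_ge0.
  + by apply: (measurableT_comp (measurable_poweR p)); exact: measurableT_comp.
  + by apply: (measurableT_comp (measurable_poweR p)); exact: measurableT_comp.
  + by rewrite !gee0_abs//; apply: ge0_le_poweR => //; exact: ltW.
Qed.

(** The supremum commutes with the p-th power, with the integral by monotone
    convergence, and with the p-th root. *)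
Lemma Lnorm_ereal_sup (p : R) (g : nat -> T -> \bar R) : (0 < p)%R ->
  (forall n, measurable_fun setT (g n)) ->
  (forall n x, 0 <= g n x) -> (forall x, nondecreasing_seq (g ^~ x)) ->
  Lnorm mu p%:E (fun x => ereal_sup (range (g ^~ x))) =
  ereal_sup (range (fun n => Lnorm mu p%:E (g n))).
Proof.
move=> p0 mg g0 ndg.
have mgp n : measurable_fun setT (fun x => g n x `^ p).
  exact: (measurableT_comp (measurable_poweR p)).
have ndgp x : nondecreasing_seq (fun n => g n x `^ p).
  by move=> m n mn; apply: ge0_le_poweR => //; [exact: ltW|exact: ndg].
rewrite unlock ereal_sup_poweR ?invr_gt0//; last first.
  by move=> n; apply: integral_ge0 => x _; exact: poweR_ge0.
congr poweR.
have -> : (fun n => \int[mu]_x `|g n x| `^ p) = (fun n => \int[mu]_x (g n x `^ p)).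
  by apply/funext => n; apply: eq_integral => x _; rewrite gee0_abs.
have -> : \int[mu]_x `|ereal_sup (range (g ^~ x))| `^ p =
    \int[mu]_x limn (fun n => g n x `^ p).
  apply: eq_integral => x _.
  rewrite gee0_abs; last first.
    by apply: le_trans (g0 0%N x) _; apply: ereal_sup_ubound; exists 0%N.
  rewrite -ereal_sup_poweR//; apply/esym/cvg_lim => //.
  exact: ereal_nondecreasing_cvgn.
rewrite monotone_convergence//; last by move=> n x _; exact: poweR_ge0.
apply/cvg_lim => //; apply: ereal_nondecreasing_cvgn => m n mn.
apply: ge0_le_integral => // [x _|x _]; first exact: poweR_ge0.
exact: ndgp.
Qed.

End Lnorm.

(** * Measurability of the dyadic blocks *)

Section measurable_ell.
Context d (T : measurableType d) (R : realType).
Local Open Scope ereal_scope.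

Lemma measurable_ell_norm (q : \bar R) (P : pred nat) (a : nat -> T -> \bar R) :
  (forall j x, 0 <= a j x) -> (forall j, measurable_fun setT (a j)) ->
  measurable_fun setT (fun x => ell_norm q P (a ^~ x)).
Proof.
move=> a0 ma.
have msup : measurable_fun setT
    (fun x => ereal_sup [set a j x | j in [set j | P j]]).
  rewrite (_ : (fun x => _) =
      (fun x => esups (fun j => if P j then a j x else -oo) 0%N)).
    (* excluded indices contribute -oo, which no supremum notices *)
    apply: measurable_fun_esups => j; case: (P j); [exact: ma|exact: measurable_cst].
  apply/funext => x; apply/eqP; rewrite eq_le; apply/andP; split.
    apply: ereal_sup_le => _ [j /= Pj <-]; exists j => //=.
    by rewrite ifT.
  apply: ge_ereal_sup => _ [j _ <-] /=; case: ifPn => [Pj|_]; last by rewrite leNye.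
  by apply: ereal_sup_ubound; exists j.
case: q => [q| |]; [|exact: msup|exact: msup].
apply: (measurableT_comp (measurable_poweR q^-1)).
apply: ge0_emeasurable_sum => [j x _ _|j _]; first exact: poweR_ge0.
exact: (measurableT_comp (measurable_poweR q)).
Qed.

End measurable_ell.

Section measurable_rV_continuous.
Context {R : realType} {n : nat}.

(** An open set is a countable union of cubes with rational centre and
    radius 1/(k+1), and a cube is an intersection of preimages of intervals
    under the coordinates. *)
Lemma open_measurable_rV (U : set 'rV[R]_n) : open U -> measurable U.
Proof.
pose B (ck : 'rV[rat]_n * nat) :=
  [set x : 'rV[R]_n | forall i, ball (ratr (ck.1 ord0 i) : R) ck.2.+1%:R^-1 (x ord0 i)].
have mB ck : measurable (B ck).
  rewrite (_ : B ck = \bigcap_(i in setT) ((fun x : 'rV[R]_n => x ord0 i) @^-1`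
      ball (ratr (ck.1 ord0 i) : R) ck.2.+1%:R^-1)); last first.
    by apply/seteqP; split => x /= h; [move=> i _; exact: h|move=> i; exact: h].
  apply: fin_bigcap_measurable => // i _.
  rewrite -[X in measurable X]setTI; apply: measurable_coord => //.
  exact: measurable_ball.
move=> oU; rewrite (_ : U = \bigcup_ck (if `[< B ck `<=` U >] then B ck else set0)).
  apply: countable_bigcupT_measurable => [|ck]; first exact: countableP.
  by case: ifP.
apply/seteqP; split => x; last by case=> ck _; case: ifPn => // /asboolP; exact.
move=> Ux; have /nbhs_ballP[e e0 xeU] : nbhs x U by move: oU; rewrite openE; exact.
(* the cube through x has diameter at most 2/(k+1), below the radius e *)
have [k ke] : exists k, k.+1%:R^-1 < e / 2.
  have := near_infty_natSinv_lt (PosNum (divr_gt0 e0 (@ltr0n R 2))).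
  by case=> k _ /(_ k (leqnn _)) ?; exists k.
have /choice[c cx] : forall i : 'I_n, exists q : rat,
    ball (ratr q : R) k.+1%:R^-1 (x ord0 i).
  move=> i; have : x ord0 i < x ord0 i + k.+1%:R^-1 by rewrite ltrDl invr_gt0.
  move=> /rat_in_itvoo[q]; rewrite in_itv/= => /andP[xq qx]; exists q.
  by rewrite /ball/= ger0_norm ?subr_ge0 ?(ltW xq)// ltrBlDl.
exists (\row_i c i, k) => //; rewrite ifT; first by move=> i /=; rewrite mxE.
apply/asboolP => y yB; apply: xeU; split => // i0 i.
rewrite (ord1 i0); have := yB i; rewrite /= mxE => cy.
rewrite (splitr e); apply: (@ball_triangle _ _ (ratr (c i) : R)).
  by apply: ball_sym; apply: le_ball (cx i); exact: ltW.
by apply: le_ball cy; exact: ltW.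
Qed.

Lemma continuous_measurable_rV (g : 'rV[R]_n -> R) :
  continuous g -> measurable_fun setT g.
Proof.
move=> /continuousP cg.
apply: (measurability _ (RGenOpens.measurableE R)).
move=> _ [_ [a [b ->] <-]]; rewrite setTI.
apply: open_measurable_rV; apply: cg; exact: interval_open.
Qed.

Lemma measurable_dotp : measurable_fun setT
  (fun z : 'rV[R]_n * 'rV[R]_n => dotp z.1 z.2).
Proof.
apply: measurable_sum => i; apply: measurable_funM.
  exact: (measurableT_comp (measurable_coord i) measurable_fst).
exact: (measurableT_comp (measurable_coord i) measurable_snd).
Qed.

End measurable_rV_continuous.

Section measurable_complex.
Context {R : realType}.

(** Componentwise, as are the derivatives and integrals of complex-valued
    functions. *)
Definition cmeasurable {d} {T : measurableType d} (h : T -> R[i]) :=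
  measurable_fun setT (fun x => Re (h x)) /\
  measurable_fun setT (fun x => Im (h x)).

Lemma cmeasurable_comp {d d'} {T : measurableType d} {T' : measurableType d'}
    {h : T -> R[i]} {g : T' -> T} :
  cmeasurable h -> measurable_fun setT g -> cmeasurable (h \o g).
Proof.
move=> [mr mi] mg.
by split; [exact: (measurableT_comp mr mg)|exact: (measurableT_comp mi mg)].
Qed.

Lemma cmeasurable_cst d (T : measurableType d) (c : R[i]) :
  cmeasurable (fun _ : T => c).
Proof. by split; exact: measurable_cst. Qed.

Lemma cmeasurableB d (T : measurableType d) (g h : T -> R[i]) :
  cmeasurable g -> cmeasurable h -> cmeasurable (fun x => g x - h x).
Proof.
move=> [gr gi] [hr hi]; split.
  rewrite (_ : (fun x => _) = (fun x => Re (g x) - Re (h x))).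
    exact: measurable_funB.
  by apply/funext => x; case: (g x); case: (h x).
rewrite (_ : (fun x => _) = (fun x => Im (g x) - Im (h x))).
  exact: measurable_funB.
by apply/funext => x; case: (g x); case: (h x).
Qed.

Lemma cmeasurableM d (T : measurableType d) (g h : T -> R[i]) :
  cmeasurable g -> cmeasurable h -> cmeasurable (fun x => g x * h x).
Proof.
move=> [gr gi] [hr hi]; split.
  rewrite (_ : (fun x => _) =
      (fun x => Re (g x) * Re (h x) - Im (g x) * Im (h x))).
    by apply: measurable_funB; exact: measurable_funM.
  by apply/funext => x; case: (g x); case: (h x).
rewrite (_ : (fun x => _) =
    (fun x => Re (g x) * Im (h x) + Im (g x) * Re (h x))).
  by apply: measurable_funD; exact: measurable_funM.
by apply/funext => x; case: (g x); case: (h x).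
Qed.

Lemma cmeasurable_expi d (T : measurableType d) (t : T -> R) :
  measurable_fun setT t -> cmeasurable (fun x => expi (t x)).
Proof.
move=> mt; split => /=.
  exact: (measurableT_comp (continuous_measurable_fun (@continuous_cos R))).
exact: (measurableT_comp (continuous_measurable_fun (@continuous_sin R))).
Qed.

Lemma measurable_normc d (T : measurableType d) (h : T -> R[i]) :
  cmeasurable h -> measurable_fun setT (fun x => normc (h x)).
Proof.
move=> [hr hi].
rewrite (_ : (fun x => _) = (fun x => Num.sqrt (Re (h x) ^+ 2 + Im (h x) ^+ 2))).
  apply: (measurableT_comp (continuous_measurable_fun (@sqrt_continuous R))).
  by apply: measurable_funD; exact: measurable_funX.
by apply/funext => x; case: (h x).
Qed.

(** The positive and negative parts of h have measurable integrals by Tonelli,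
    and the difference of two measurable extended-real functions is measurable,
    whatever value it takes where both are infinite. *)
Lemma measurable_Rintegral_param {d1 d2} {T1 : measurableType d1}
    {T2 : measurableType d2} (m : {sigma_finite_measure set T2 -> \bar R})
    {h : T1 * T2 -> R} : measurable_fun setT h ->
  measurable_fun setT (fun x => \int[m]_y h (x, y)).
Proof.
move=> mh; rewrite /Rintegral; apply: (measurableT_comp (fine_measurable measurableT)).
have mE : measurable_fun setT (EFin \o h) by exact/measurable_EFinP.
rewrite (_ : (fun x => _) = (fun x => fubini_F m (EFin \o h)^\+ x -
    fubini_F m (EFin \o h)^\- x)%E); last first.
  apply/funext => x; rewrite integralE; congr (_ - _)%E; apply: eq_integral => y _.
    by rewrite !funeposE.
  by rewrite !funenegE.
apply: emeasurable_funB.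
  apply: measurable_fun_fubini_tonelli_F; first exact: measurable_funepos.
  by move=> x; exact: funepos_ge0.
apply: measurable_fun_fubini_tonelli_F; first exact: measurable_funeneg.
by move=> x; exact: funeneg_ge0.
Qed.

Lemma cmeasurable_cintegral {d} {T : measurableType d} {n}
    (h : T * 'rV[R]_n -> R[i]) : cmeasurable h ->
  cmeasurable (fun x => cintegral (fun y => h (x, y))).
Proof.
move=> [hr hi]; split => /=.
  exact: (measurable_Rintegral_param _ hr).
exact: (measurable_Rintegral_param _ hi).
Qed.

End measurable_complex.

Section blocks.
Context {R : realType} {d : nat}.
Implicit Types (f : 'rV[R]_d -> R[i]).

Lemma csmooth_cmeasurable {f} : csmooth f -> cmeasurable f.
Proof.
by move=> [/(_ [::])[cr _] /(_ [::])[ci _]]; split;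
  exact: continuous_measurable_rV.
Qed.

Lemma cmeasurable_inv_fourier f : cmeasurable f -> cmeasurable (inv_fourier f).
Proof.
move=> mf; apply: cmeasurableM; first exact: cmeasurable_cst.
apply: (cmeasurable_cintegral (fun z => expi (dotp z.1 z.2) * f z.2)).
apply: cmeasurableM; first by apply: cmeasurable_expi; exact: measurable_dotp.
by apply: (cmeasurable_comp mf); exact: measurable_snd.
Qed.

(** Reduces the measurability of the Fourier transform to that of its
    inverse. *)
Lemma fourierE f xi : fourier f xi = inv_fourier f (- xi).
Proof.
congr (_ * cintegral _); apply/funext => x; congr (expi _ * _).
by rewrite /dotp -sumrN; apply: eq_bigr => i _; rewrite mxE mulNr mulrC.
Qed.

Lemma measurable_scale (c : R) : measurable_fun setT (fun x : 'rV[R]_d => c *: x).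
Proof.
apply: measurable_fun_rVP => i; under eq_fun do rewrite mxE.
by apply: measurable_funM => //; exact: measurable_coord.
Qed.

Lemma cmeasurable_fourier f : cmeasurable f -> cmeasurable (fourier f).
Proof.
move=> /cmeasurable_inv_fourier mf; rewrite (_ : fourier f =
    inv_fourier f \o (fun x => -1 *: x)).
  exact: (cmeasurable_comp mf (measurable_scale _)).
by apply/funext => xi; rewrite /= scaleN1r fourierE.
Qed.

Lemma cmeasurable_dyadic (phi0 : 'rV[R]_d -> R[i]) j :
  cmeasurable phi0 -> cmeasurable (dyadic phi0 j).
Proof.
move=> mphi; case: j => [//|j]; apply: cmeasurableB.
  exact: (cmeasurable_comp mphi (measurable_scale _)).
exact: (cmeasurable_comp mphi (measurable_scale _)).
Qed.

Lemma cmeasurable_dyadic_block (phi0 : 'rV[R]_d -> R[i]) j f :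
  cmeasurable phi0 -> cmeasurable f ->
  cmeasurable (dyadic_block phi0 j f).
Proof.
move=> mphi mf; apply: cmeasurable_inv_fourier; apply: cmeasurableM.
  exact: cmeasurable_dyadic.
exact: cmeasurable_fourier.
Qed.

End blocks.

Theorem theorem17p20 (R : realType) (d : nat) (p q : \bar R) (r s : R)
    (phi0 : 'rV[R]_d -> complex R)
    (d_gt0 : (0 < d)%N) (p_gt0 : (0 < p)%E) (q_gt0 : (0 < q)%E) (r_gt0 : 0 < r)
    (phi0P : dyadic_generator phi0)
    (f : 'rV[R]_d -> complex R) (fS : schwartz f) :
  ((((1 - 2 `^ (b * r)) `^ r^-1)%:E * TBnorm phi0 b r p q s f)%E
     @[b --> (0 : R)^'-] --> Bnorm phi0 p q s f)
  /\
  ((p < +oo)%E ->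
   (((1 - 2 `^ (b * r)) `^ r^-1)%:E * TFnorm phi0 b r p q s f)%E
     @[b --> (0 : R)^'-] --> Fnorm phi0 p q s f).
Proof.
have sub m n nu : (m <= n)%N -> (nu <= 2 ^ m)%N -> (nu <= 2 ^ n)%N.
  by move=> mn /leq_trans; apply; rewrite leq_exp2l.
have weight0 j (x : \bar R) : (0 <= x)%E -> (0 <= (2 `^ (j%:R * s))%:E * x)%E.
  by move=> x0; rewrite mule_ge0// lee_fin powR_ge0.
split=> [|poo].
  rewrite /Bnorm /BnormP ell_norm_sup_trunc//; last first.
    by move=> j; apply: weight0; exact: Lnorm_ge0.
  apply: abel_mean_cvg => // [n|m n mn].
    by apply: ell_norm_ge0 => // j; apply: weight0; exact: Lnorm_ge0.
  apply: le_ell_norm => // [j|nu]; first by apply: weight0; exact: Lnorm_ge0.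
  exact: sub.
case: p p_gt0 poo => // p; rewrite lte_fin => p0 _.
have [[phi0S _ _ _] [fS' _]] := (phi0P, fS).
have mphi0 := csmooth_cmeasurable phi0S; have mf := csmooth_cmeasurable fS'.
pose a j x := ((2 `^ (j%:R * s))%:E * (normc (dyadic_block phi0 j f x))%:E)%E.
have a0 j x : (0 <= a j x)%E.
  by apply: weight0; rewrite lee_fin; case: dyadic_block => u v; exact: sqrtr_ge0.
have ma j : measurable_fun setT (a j).
  apply: emeasurable_funM => //; apply/measurable_EFinP/measurable_normc.
  exact: cmeasurable_dyadic_block.
pose g n x := ell_norm q (fun nu => nu <= 2 ^ n)%N (a ^~ x).
have mg n : measurable_fun setT (g n) by exact: measurable_ell_norm.
have g0 n x : (0 <= g n x)%E by exact: ell_norm_ge0.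
have ndg x : nondecreasing_seq (g ^~ x).
  by move=> m n mn; apply: le_ell_norm => // nu; exact: sub.
rewrite /Fnorm /FnormP.
have -> : (fun x => ell_norm q xpredT (a ^~ x)) =
    (fun x => ereal_sup (range (g ^~ x))).
  by apply/funext => x; exact: ell_norm_sup_trunc.
rewrite Lnorm_ereal_sup//.
apply: abel_mean_cvg => // [n|m n mn]; first exact: Lnorm_ge0.
by apply: le_Lnorm => // [||x|x]; [exact: mg|exact: mg|exact: g0|exact: ndg].
Qed.
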